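(* Let $u^*\in\mathcal A_{\mathbb F}$ with corresponding controlled state process $X_*=X^{u^*}$. Suppose there exists a solution $(Y_*(t),Z_*(t))$ of the adjoint equation (see context) associated with $(u^*,X_* )$. Assume the following: 1. $X^u(t)Z_*(t)$ belongs to the domain of the divergence operator $\delta^H$ of $B^H$ for all $u\in\mathcal A_{\mathbb F}$. 2. (Concavity) The functions $(x,\bar x,u,m_1,m_2,m_3)\mapsto H(t,x,\bar x,u,m_1,m_2,m_3,Y_*(t),Z_*(t))$ and $(x,m)\mapsto g(x,m)$ are concave for each $t\in[0,T]$ almost surely. 3. (Maximum condition) For all $t\in[0,T]$, almost surely, $$H(t,X_*(t),X_*(t-\delta),u^*(t),\mathbb P_{X_*(t)},\mathbb P_{X_*(t-\delta)},\mathbb P_{u^*(t)},Y_*(t),Z_*(t))=\sup_{u\in\mathcal U}H(t,X_*(t),X_*(t-\delta),u,\mathbb P_{X_*(t)},\mathbb P_{X_*(t-\delta)},\mathbb P_{u^*(t)},Y_*(t),Z_*(t)).$$ 4. For all $t\in[0,T]$, almost surely, $$\partial_{m_3}H(t,X_*(t),X_*(t-\delta),u^*(t),\mathbb P_{X_*(t)},\mathbb P_{X_*(t-\delta)},\mathbb P_{u^*(t)},Y_*(t),Z_*(t))(u^*(t))=0.$$ Then $(u^*,X_* )$ is an optimal couple, i.e. $J(u^* )=\sup_{u\in\mathcal A_{\mathbb F}}J(u)$.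
   Context: **Setting.** Let $T>0$, $\delta>0$ (a constant delay), and let $B^H$ be a fractional Brownian motion with Hurst parameter in $(1/2,1)$ on a complete probability space $(\Omega,\mathcal F,\mathbb P)$, with $\mathbb F=(\mathcal F_t)$ the filtration it generates. With $\phi(x)=H(2H-1)|x|^{2H-2}$ (here $H$ is the Hurst parameter), $\mathcal H$ is the completion of the continuous functions on $[0,T]$ under $\langle\xi,\psi\rangle_T=\int_0^T\int_0^T\phi(u-v)\xi_u\psi_v\,du\,dv$. The divergence operator $\delta^H$ is the adjoint of the Malliavin derivative $D^H$ of $B^H$: $u\in \mathrm{dom}(\delta^H)$ if there is $\delta^H(u)\in L^2(\Omega,\mathcal{F},\mathbb{P})$ with $\mathbb{E}(\Phi\delta^H(u))=\mathbb{E}\langle D^H_\cdot\Phi,u\rangle_T$ for all polynomial functionals $\Phi$ of $B^H$; $\int_0^T u_s\,dB^H_s:=\delta^H(u)$, and all $dB^H$-integrals are of this type. $\mathbb P_\xi$ denotes the law of $\xi$, and $\mathcal P_2(\mathbb{R})$ the set of probability measures on $\mathbb{R}$ with finite second moment. **State.** $\mathcal U\subset\mathbb{R}$ is the set of control values; $\mathcal A_{\mathbb F}$ is the set of $\mathcal U$-valued, $\mathbb F$-adapted, square-integrable processes. For $u\in\mathcal A_{\mathbb F}$, $X=X^u$ solves $$dX(t)=b(t,\mathbb P_{X(t)},\mathbb P_{X(t-\delta)},\mathbb P_{u(t)})dt+\sigma(t)dB^H_t,\ t\in[0,T];\qquad X(t)=x_0(t),\ t\in[-\delta,0],$$ where $\sigma\in\mathcal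 H$ is deterministic, $b:[0,T]\times\mathcal P_2(\mathbb{R})^3\to\mathbb{R}$ is deterministic, and $x_0$ is continuous and deterministic. It is assumed that $X^u$ exists and belongs to $L^2(\Omega\times[0,T])$. **Performance functional.** $$J(u)=\mathbb{E}\Big[g(X(T),\mathbb P_{X(T)})+\int_0^Tf(t,X(t),X(t-\delta),\mathbb P_{X(t)},\mathbb P_{X(t-\delta)},u(t))dt\Big],$$ with $f:\Omega\times[0,T]\times\mathbb{R}^2\times\mathcal P_2(\mathbb{R})^2\times\mathcal U\to\mathbb{R}$, $g:\Omega\times\mathbb{R}\times\mathcal P_2(\mathbb{R})\to\mathbb{R}$; $f(\cdot,t,x,\bar x,m,\bar m,u)$ is $\mathcal F_t$-measurable and $g(\cdot,x,m)$ is $\mathcal F_T$-measurable for all arguments. It is assumed that $\mathbb{E}\big[|g(X(T),\mathbb P_{X(T)})|+\int_0^T|f(t,X(t),X(t-\delta),\mathbb P_{X(t)},\mathbb P_{X(t-\delta)},u(t))|dt\big]<\infty$. The functions $b,f,g$ are continuously differentiable in $x,\bar x,u$ with bounded derivatives and have bounded Fréchet derivatives with respect to the measure arguments. **Measure derivative.** A function $F:\mathcal P_2(\mathbb{R})\to\mathbb{R}$ is differentiable at $m_0$ if its lift $\xi\mapsto F(\mathbb P_\xi)$ on $L^2(\Omega,\mathcal F,\mathbb P)$ is Fréchet differentiable at some $\xi_0$ with law $m_0$; the derivative, seen as an element of $L^2$, has the form $\partial_mF(m_0)(\xi_0)$ with $\partial_mF(m_0):\mathbb{R}\to\mathbb{R}$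 Borel, which defines $\partial_mF(m_0)(\cdot)$ ($m_0$-a.e.). **Concavity.** A differentiable function $F$ of real variables $a=(a_1,\dots,a_k)$ and measures $(m_1,\dots,m_l)$ is concave if for all $(a,m),(a',m')$, $$F(a',m')-F(a,m)-\sum_i\partial_{a_i}F(a,m)(a_i'-a_i)-\sum_j\mathbb{E}[\partial_{m_j}F(a,m)(X_j)(X_j'-X_j)]\le0$$ whenever $X_j,X_j'\in L^2$ have laws $m_j,m_j'$ (the expectation is taken over the $X_j,X_j'$ only). **Hamiltonian.** $H(t,x,\bar x,u,m_1,m_2,m_3,y,z)=f(t,x,\bar x,m_1,m_2,u)+y\,b(t,m_1,m_2,m_3)+z\,\sigma(t)$. **Adjoint equation.** Associated with $(u,X)$, for the unknown $(Y,Z)$: $$\begin{cases}dY(t)=-\Big\{\partial_xH(t)+\mathbb{E}\big[\partial_{\bar x}H(t+\delta)\chi_{[0,T-\delta]}(t)\,|\,\mathcal F_t\big]+\mathbb{E}'\big[\partial_{m_1}H'(t)(X(t))\big]\\ \qquad\qquad+\mathbb{E}\big[\mathbb{E}'[\partial_{m_2}H'(t+\delta)(X(t))\chi_{[0,T-\delta]}(t)]\,|\,\mathcal F_t\big]\Big\}dt+Z(t)dB^H(t),\quad t\in[0,T],\\ Y(T)=\partial_xg(T)+\mathbb{E}'[\partial_mg'(T)(X(T))],\end{cases}$$ where $\chi$ is the indicator function and $H(t)=H(t,X(t),X(t-\delta),u(t),\mathbb P_{X(t)},\mathbb P_{X(t-\delta)},\mathbb P_{u(t)},Y(t),Z(t))$,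 $H'(t)=H(t,X'(t),X'(t-\delta),u'(t),\mathbb P_{X(t)},\mathbb P_{X(t-\delta)},\mathbb P_{u(t)},Y'(t),Z'(t))$, $g(T)=g(X(T),\mathbb P_{X(T)})$, $g'(T)=g(X'(T),\mathbb P_{X(T)})$. Here, on the product space $\Omega\times\Omega$ with $\mathbb P\otimes\mathbb P$, $\xi'(\omega',\omega)=\xi(\omega')$ for a random variable $\xi$ on $\Omega$, and $\mathbb{E}'[\theta](\omega)=\int_\Omega\theta(\omega',\omega)\mathbb P(d\omega')$ (so primed processes are integrated out while $X(t),X(T)$ inside $\mathbb{E}'$ are evaluated at $\omega$).
   Formalization: The control set U is assumed to be open or an interval (the claim fails for U={0,1}), and in condition 4 the random arguments of H are frozen while u*(t) is evaluated on an independent copy (the same-ω reading is false). *)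

(* Defs.v *)
From HB Require Import structures.
From mathcomp Require Import all_boot all_order all_algebra.
From mathcomp Require Import all_classical all_reals all_analysis.
From mathcomp Require mpoly.

Set Implicit Arguments.
Unset Strict Implicit.
Unset Printing Implicit Defensive.
Import Order.TTheory GRing.Theory Num.Theory.
Import numFieldNormedType.Exports.

Local Open Scope classical_set_scope.
Local Open Scope ring_scope.

(* A function on P_2(R) is a function on all of [law R] whose values matter
   only at the measures satisfying [P2]. *)
Definition law (R : realType) := probability R R.

Definition P2 (R : realType) (m : law R) : Prop :=
  (\int[m]_x (x ^+ 2)%:E < +oo)%E.

Section relative_derivative.
Context (R : realType).
Implicit Types (U : set R) (F : R -> R) (u : R).

(* Derivative of a function defined on U, the increments staying in U: it is
   the one-sided derivative at an end point of an interval. *)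
Definition derivable_in U F u : Prop :=
  cvg ((F v - F u) / (v - u) @[v --> within U u^']).

Definition derive_in U F u : R :=
  lim ((F v - F u) / (v - u) @[v --> within U u^']).

End relative_derivative.

Section measure_arguments.
Context d (Om : measurableType d) (R : realType) (P : probability Om R).

Definition L2 := LfunType P (@lee1n R 2).

Definition L2norm (xi : Om -> R) : R := fine ('N[P]_2%:E[EFin \o xi]).

(* A [probability] is a function on all sets, unspecified on nonmeasurable
   ones; equality of laws is therefore tested on measurable sets. *)
Definition has_law (xi : {RV P >-> R}) (m : law R) : Prop :=
  forall A : set (measurableTypeR R), measurable A -> distribution P xi A = m A.

(* D is a version of the derivative d_m F(m0): the lift xi |-> F(P_xi) is
   Frechet differentiable on L^2 at some xi0 of law m0, with differential
   represented by D(xi0). *)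
Definition is_mderiv (F : law R -> R) (m0 : law R) (D : R -> R) : Prop :=
  D \in Lfun m0 2%:E /\
  exists2 xi0 : L2, has_law xi0 m0 &
    forall e : R, 0 < e -> exists2 r : R, 0 < r &
      forall eta : L2, L2norm eta <= r ->
        `|F (distribution P (xi0 + eta)) - F (distribution P xi0)
          - \int[P]_w (D (xi0 w) * eta w)| <= e * L2norm eta.

Definition has_bounded_mderiv (C : R) (F : law R -> R) (m0 : law R) : Prop :=
  exists2 D, is_mderiv F m0 D & ('N[m0]_2%:E[EFin \o D] <= C%:E)%E.

(* Concavity in (x, xb, u, m1, m2, m3), u ranging over U; Di is a version of
   the derivative with respect to mi. *)
Definition concave_H (U : set R)
    (F : R -> R -> R -> law R -> law R -> law R -> R)
    (D1 D2 D3 : R -> R -> R -> law R -> law R -> law R -> R -> R) : Prop :=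
  forall (x xb u x' xb' u' : R) (m1 m2 m3 m1' m2' m3' : law R)
         (X1 X2 X3 X1' X2' X3' : L2),
    U u -> U u' ->
    has_law X1 m1 -> has_law X2 m2 -> has_law X3 m3 ->
    has_law X1' m1' -> has_law X2' m2' -> has_law X3' m3' ->
    F x' xb' u' m1' m2' m3' - F x xb u m1 m2 m3
    - derive1 (fun s => F s xb u m1 m2 m3) x * (x' - x)
    - derive1 (fun s => F x s u m1 m2 m3) xb * (xb' - xb)
    - derive_in U (fun s => F x xb s m1 m2 m3) u * (u' - u)
    - \int[P]_w (D1 x xb u m1 m2 m3 (X1 w) * (X1' w - X1 w))
    - \int[P]_w (D2 x xb u m1 m2 m3 (X2 w) * (X2' w - X2 w))
    - \int[P]_w (D3 x xb u m1 m2 m3 (X3 w) * (X3' w - X3 w)) <= 0.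

Definition concave_g (F : R -> law R -> R) (D : R -> law R -> R -> R) : Prop :=
  forall (x x' : R) (m m' : law R) (X X' : L2),
    has_law X m -> has_law X' m' ->
    F x' m' - F x m - derive1 (fun s => F s m) x * (x' - x)
    - \int[P]_w (D x m (X w) * (X' w - X w)) <= 0.

End measure_arguments.

Section processes.
Context d (Om : measurableType d) (R : realType) (P : probability Om R).
Context (T : R).
Local Notation mu := (@lebesgue_measure R).
Implicit Types (xi : R -> Om -> R).

Definition strip : set (Om * measurableTypeR R) := [set: Om] `*` `[0, T].

Definition measurable_process xi : Prop :=
  measurable_fun strip (fun p => xi p.2 p.1).

Definition integrable_process xi : Prop :=
  (P \x mu)%E.-integrable strip (fun p => (xi p.2 p.1)%:E).

Definition sq_integrable_process xi : Prop :=
  measurable_process xi /\ integrable_process (fun t w => xi t w ^+ 2).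

End processes.

Section fractional_brownian_motion.
Context d (Om : measurableType d) (R : realType) (P : probability Om R).
Context (T h : R) (B : R -> {RV P >-> R}).
Local Notation mu := (@lebesgue_measure R).
Implicit Types (xi : R -> Om -> R) (D : Om -> R).

Definition fbm_cov (s t : R) : R :=
  2^-1 * (s `^ (2 * h) + t `^ (2 * h) - `|t - s| `^ (2 * h)).

(* B is a centered Gaussian process on [0, T] with covariance [fbm_cov]: the
   linear combinations of its values are N(0, v), with N(0, 0) a Dirac mass. *)
Definition is_fbm : Prop :=
  forall (n : nat) (t a : 'I_n -> R), (forall i, 0 <= t i <= T) ->
  let v := \sum_(i < n) \sum_(j < n) a i * a j * fbm_cov (t i) (t j) in
  forall A : set (measurableTypeR R), measurable A ->
    P ((fun w => \sum_(i < n) a i * B (t i) w) @^-1` A) =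
    if v == 0 then (\d_(0 : measurableTypeR R) A)
    else normal_prob 0 (Num.sqrt v) A.

Definition filtration (t : R) : set (set Om) :=
  <<s \bigcup_(s in `[0, t]) preimage_set_system [set: Om] (B s) measurable >>.

Definition filtration_measurable (t : R) D : Prop :=
  forall A : set (measurableTypeR R), measurable A ->
    filtration t (D @^-1` A).

Definition adapted xi : Prop :=
  forall t : R, 0 <= t <= T -> filtration_measurable t (xi t).

(* C is a version of E[D | F_t]. *)
Definition is_condexp (t : R) D (C : Om -> R) : Prop :=
  [/\ P.-integrable setT (EFin \o D), P.-integrable setT (EFin \o C),
      filtration_measurable t C &
      forall A, filtration t A -> \int[P]_(w in A) C w = \int[P]_(w in A) D w].

Definition phi (x : R) : R := h * (2 * h - 1) * `|x| `^ (2 * h - 2).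

Definition inner (x y : R -> R) : R :=
  \int[mu]_(r in `[0, T]) \int[mu]_(s in `[0, T]) (phi (r - s) * x r * y s).

(* The function x is (identified with) an element of the completion of C[0,T]
   for [inner]: some Cauchy sequence of continuous functions has the same
   limiting inner products as x against every continuous function.  For
   integrable x these inner products are absolutely convergent. *)
Definition in_calH (x : R -> R) : Prop :=
  mu.-integrable `[0, T] (EFin \o x) /\
  exists psi : nat -> R -> R,
    [/\ forall n, {within `[0, T], continuous (psi n)},
        forall e : R, 0 < e -> exists N : nat, forall m n,
          (N <= m)%N -> (N <= n)%N ->
          inner (psi m \- psi n) (psi m \- psi n) <= e &
        forall y : R -> R, {within `[0, T], continuous y} ->
          inner (psi n) y @[n --> \oo] --> inner x y].

(* Polynomial functional p(B_{t_1},...,B_{t_n}) and its Malliavin derivative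
   D^H_r = sum_i (d_i p)(B_{t_1},...,B_{t_n}) 1_[0,t_i](r). *)
Definition poly_functional n (t : 'I_n -> R) (p : mpoly.mpoly n R) (w : Om) : R :=
  mpoly.meval (fun i => B (t i) w) p.

Definition malliavin_deriv n (t : 'I_n -> R) (p : mpoly.mpoly n R)
    (w : Om) (r : R) : R :=
  \sum_(i < n) poly_functional t (mpoly.mderiv i p) w * \1_(`[0, t i]) r.

(* D is the divergence of the process u.  Requiring D to be measurable with
   respect to B costs nothing, as the duality determines D through its
   conditional expectation given B only, and it makes D a.s. unique. *)
Definition is_divergence (u : R -> Om -> R) D : Prop :=
  [/\ measurable_process T u,
      {ae P, forall w, in_calH (fun t => u t w)},
      D \in Lfun P 2%:E,
      filtration_measurable T D &
      forall n (t : 'I_n -> R) (p : mpoly.mpoly n R),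
        (forall i, 0 <= t i <= T) ->
        P.-integrable setT
          (fun w => (inner (malliavin_deriv t p w) (fun s => u s w))%:E) /\
        \int[P]_w (poly_functional t p w * D w) =
        \int[P]_w inner (malliavin_deriv t p w) (fun s => u s w)].

Definition dom_divergence (u : R -> Om -> R) : Prop :=
  exists D, is_divergence u D.

Definition divergence (u : R -> Om -> R) : Om -> R :=
  xget (fun=> 0) [set D | is_divergence u D].

End fractional_brownian_motion.

Section control_problem.
Context d (Om : measurableType d) (R : realType) (P : probability Om R).
Context (T delta h : R) (U : set R) (B : R -> {RV P >-> R}).
Context (b : R -> law R -> law R -> law R -> R) (sigma x0 : R -> R).
Context (f : Om -> R -> R -> R -> law R -> law R -> R -> R).
Context (g : Om -> R -> law R -> R).
Local Notation mu := (@lebesgue_measure R).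
Implicit Types (u X : R -> {RV P >-> R}) (Y Z : R -> Om -> R).

Local Notation "'law_' xi" := (distribution P xi : law R)
  (at level 10, xi at level 8).

Definition admissible u : Prop :=
  [/\ forall (t : R) w, 0 <= t <= T -> U (u t w), adapted T B u &
      sq_integrable_process P T u].

(* int_0^t sigma dB is the divergence of sigma 1_[0,t]. *)
Definition is_state u X : Prop :=
  [/\ forall t : R, - delta <= t <= 0 -> {ae P, forall w, X t w = x0 t},
      mu.-integrable `[0, T]
        (fun s => (b s (law_ (X s)) (law_ (X (s - delta))) (law_ (u s)))%:E) &
      forall t : R, 0 <= t <= T ->
        let sigma_t := fun (s : R) (_ : Om) => sigma s * \1_(`[0, t]) s in
        dom_divergence T h B sigma_t /\
        {ae P, forall w, X t w = x0 0
          + \int[mu]_(s in `[0, t])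
              b s (law_ (X s)) (law_ (X (s - delta))) (law_ (u s))
          + divergence T h B sigma_t w}].

Definition running_cost u X (t : R) (w : Om) : R :=
  f w t (X t w) (X (t - delta) w) (law_ (X t)) (law_ (X (t - delta))) (u t w).

Definition terminal_cost X (w : Om) : R := g w (X T w) (law_ (X T)).

Definition finite_cost u X : Prop :=
  P.-integrable setT (EFin \o terminal_cost X) /\
  integrable_process P T (running_cost u X).

Definition cost u X : R :=
  \int[P]_w (terminal_cost X w + \int[mu]_(t in `[0, T]) running_cost u X t w).

Definition hamiltonian (w : Om) (t x xb u : R) (m1 m2 m3 : law R) (y z : R) :=
  f w t x xb m1 m2 u + y * b t m1 m2 m3 + z * sigma t.

(* Regularity of the coefficients; bounds are uniform in all arguments. *)
Definition coefficients_adapted : Prop :=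
  (forall t x xb m mb v, 0 <= t <= T -> P2 m -> P2 mb -> U v ->
     filtration_measurable B t (fun w => f w t x xb m mb v)) /\
  (forall x m, P2 m -> filtration_measurable B T (fun w => g w x m)).

Definition coefficients_C1 (C : R) : Prop :=
  (forall w t m mb, 0 <= t <= T -> P2 m -> P2 mb ->
     let fx := fun p : R * R * R =>
       derive1 (fun s => f w t s p.1.2 m mb p.2) p.1.1 in
     let fxb := fun p : R * R * R =>
       derive1 (fun s => f w t p.1.1 s m mb p.2) p.1.2 in
     let fu := fun p : R * R * R =>
       derive_in U (fun s => f w t p.1.1 p.1.2 m mb s) p.2 in
     (forall x xb v, U v ->
       [/\ derivable (fun s => f w t s xb m mb v) x 1,
           derivable (fun s => f w t x s m mb v) xb 1,
           derivable_in U (fun s => f w t x xb m mb s) v &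
           [/\ `|fx (x, xb, v)| <= C, `|fxb (x, xb, v)| <= C &
               `|fu (x, xb, v)| <= C]]) /\
     [/\ {within [set p | U p.2], continuous fx},
         {within [set p | U p.2], continuous fxb} &
         {within [set p | U p.2], continuous fu}]) /\
  (forall w m, P2 m ->
     (forall x, derivable (fun s => g w s m) x 1 /\
                `|derive1 (fun s => g w s m) x| <= C) /\
     continuous (fun x => derive1 (fun s => g w s m) x)).

Definition coefficients_mderiv (C : R) : Prop :=
  [/\ forall t m1 m2 m3, 0 <= t <= T -> P2 m1 -> P2 m2 -> P2 m3 ->
        [/\ has_bounded_mderiv P C (fun m => b t m m2 m3) m1,
            has_bounded_mderiv P C (fun m => b t m1 m m3) m2 &
            has_bounded_mderiv P C (fun m => b t m1 m2 m) m3],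
      forall w t x xb m mb v, 0 <= t <= T -> P2 m -> P2 mb -> U v ->
        has_bounded_mderiv P C (fun m' => f w t x xb m' mb v) m /\
        has_bounded_mderiv P C (fun m' => f w t x xb m m' v) mb &
      forall w x m, P2 m ->
        has_bounded_mderiv P C (fun m' => g w x m') m].

(* dHi and dg are versions, for all values of the arguments, of the measure
   derivatives of the Hamiltonian and of g. *)
Context (dH1 dH2 dH3 :
  Om -> R -> R -> R -> R -> law R -> law R -> law R -> R -> R -> R -> R).
Context (dg : Om -> R -> law R -> R -> R).

Definition are_mderivs : Prop :=
  (forall w t x xb v m1 m2 m3 y z,
     0 <= t <= T -> U v -> P2 m1 -> P2 m2 -> P2 m3 ->
     [/\ is_mderiv P (fun m => hamiltonian w t x xb v m m2 m3 y z) m1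
           (dH1 w t x xb v m1 m2 m3 y z),
         is_mderiv P (fun m => hamiltonian w t x xb v m1 m m3 y z) m2
           (dH2 w t x xb v m1 m2 m3 y z) &
         is_mderiv P (fun m => hamiltonian w t x xb v m1 m2 m y z) m3
           (dH3 w t x xb v m1 m2 m3 y z)]) /\
  (forall w x m, P2 m -> is_mderiv P (fun m' => g w x m') m (dg w x m)).

Section along.
Variables (u X : R -> {RV P >-> R}) (Y Z : R -> Om -> R).

(* Value along (u, X, Y, Z), at time t and scenario w, of a function of the
   arguments of the Hamiltonian. *)
Definition along (V : Type)
    (F : Om -> R -> R -> R -> R -> law R -> law R -> law R -> R -> R -> V)
    (t : R) (w : Om) : V :=
  F w t (X t w) (X (t - delta) w) (u t w)
    (law_ (X t)) (law_ (X (t - delta))) (law_ (u t)) (Y t w) (Z t w).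

Definition hamiltonian_x (t : R) (w : Om) : R :=
  along (fun w t x xb v m1 m2 m3 y z =>
    derive1 (fun s => hamiltonian w t s xb v m1 m2 m3 y z) x) t w.

Definition hamiltonian_xb (t : R) (w : Om) : R :=
  along (fun w t x xb v m1 m2 m3 y z =>
    derive1 (fun s => hamiltonian w t x s v m1 m2 m3 y z) xb) t w.

Definition chi (t : R) : R := \1_(`[0, T - delta]) t.

(* Integrands of E': w' is the integrated (primed) scenario. *)
Definition mfield1 (t : R) (w' w : Om) : R := along dH1 t w' (X t w).

Definition mfield2 (t : R) (w' w : Om) : R :=
  along dH2 (t + delta) w' (X t w) * chi t.

Definition mfieldT (w' w : Om) : R := dg w' (X T w') (law_ (X T)) (X T w).

Definition adjoint_terminal (w : Om) : R :=
  derive1 (fun s => g w s (law_ (X T))) (X T w) + \int[P]_w' mfieldT w' w.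

(* Solution of the adjoint equation, in the integrated form
   Y(t) = Y(T) + int_t^T {...} ds - int_t^T Z dB, together with the existence
   of the expectations and integrals it involves.  C1 and C2 are versions of
   the two conditional expectations given F_t. *)
Definition adjoint_solution : Prop :=
  [/\ measurable_process T Y /\ adapted T B Y,
      measurable_process T Z /\ adapted T B Z,
      P.-integrable setT
        (fun w => (derive1 (fun s => g w s (law_ (X T))) (X T w))%:E) /\
      (P \x P)%E.-integrable setT (fun p => (mfieldT p.1 p.2)%:E) &
      exists C1 C2 : R -> Om -> R,
      let drift := fun (t : R) (w : Om) =>
        hamiltonian_x t w + C1 t w + \int[P]_w' mfield1 t w' w + C2 t w in
      [/\ {ae mu, forall t : R, 0 <= t <= T ->
            (P \x P)%E.-integrable setT (fun p => (mfield1 t p.1 p.2)%:E) /\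
            (P \x P)%E.-integrable setT (fun p => (mfield2 t p.1 p.2)%:E)},
          {ae mu, forall t : R, 0 <= t <= T ->
            is_condexp B t (fun w => hamiltonian_xb (t + delta) w * chi t)
              (C1 t) /\
            is_condexp B t (fun w => \int[P]_w' mfield2 t w' w) (C2 t)},
          [/\ integrable_process P T hamiltonian_x,
              integrable_process P T C1,
              integrable_process P T (fun t w => \int[P]_w' mfield1 t w' w) &
              integrable_process P T C2],
          {ae P, forall w, Y T w = adjoint_terminal w} &
          forall t : R, 0 <= t <= T ->
            let Z_t := fun (s : R) (w : Om) => Z s w * \1_(`[t, T]) s in
            dom_divergence T h B Z_t /\
            {ae P, forall w, Y t w = Y T w
              + \int[mu]_(s in `[t, T]) drift s w
              - divergence T h B Z_t w}]].

End along.

End control_problem.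

(* Main.v *)
(* The noise is additive, so that the state X of a control u exceeds the
   candidate state Xs by a deterministic gap, the primitive of
   beta(t) = b(t, laws along u) - b(t, laws along us).  At almost every time t,
   concavity bounds f - fs + beta Ys by the first-order terms of the
   Hamiltonian; the term in the control is nonpositive by the maximum
   condition, the one in its law is zero, and the others are multiples of
   gap(t) and gap(t - delta).  As divergences have mean zero, E[Ys(t)] is
   E[Ys(T)] plus the integral over [t, T] of the mean drift of Ys.  By Fubini on
   the square and a shift by delta, the integral of beta E[Ys] equals the
   integral of those first-order terms plus gap(T) E[Ys(T)], and concavity of g
   bounds the difference of the terminal costs by gap(T) E[Ys(T)]. *)
Require Import Defs.
From HB Require Import structures.
From mathcomp Require Import all_boot all_order all_algebra.
From mathcomp Require Import all_classical all_reals all_analysis.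
From mathcomp Require Import measurable_realfun.
From mathcomp Require Import lra.

Set Implicit Arguments.
Unset Strict Implicit.
Unset Printing Implicit Defensive.
Import Order.TTheory GRing.Theory Num.Theory.
Import numFieldNormedType.Exports.

Local Open Scope classical_set_scope.
Local Open Scope ring_scope.

Section almost_everywhere.
Context d (T : measurableType d) (R : realType).
Variable mu : {measure set T -> \bar R}.
Implicit Types (D : set T) (f g : T -> R).

Lemma ae_eq_integrable D f g : measurable D -> measurable_fun D g ->
  {ae mu, forall x, D x -> f x = g x} ->
  mu.-integrable D (EFin \o f) -> mu.-integrable D (EFin \o g).
Proof.
move=> mD mg fg /integrableP[mf foo].
have mg' : measurable_fun D (fun x => (g x)%:E) by exact/measurable_EFinP.
apply/integrableP; split=> //; rewrite (ae_eq_integral (abse \o (EFin \o f)))//.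
- exact: measurableT_comp.
- exact: measurableT_comp.
- by apply: filterS fg => x fgx Dx /=; rewrite fgx.
Qed.

Lemma ae_eq_Rintegral D f g : measurable D ->
  measurable_fun D f -> measurable_fun D g ->
  {ae mu, forall x, D x -> f x = g x} ->
  \int[mu]_(x in D) f x = \int[mu]_(x in D) g x.
Proof.
move=> mD mf mg fg; congr fine; apply: ae_eq_integral => //.
- exact/measurable_EFinP.
- exact/measurable_EFinP.
- by apply: filterS fg => x fgx Dx /=; rewrite fgx.
Qed.

Lemma ae_le_Rintegral D f g : measurable D ->
  mu.-integrable D (EFin \o f) -> mu.-integrable D (EFin \o g) ->
  {ae mu, forall x, D x -> f x <= g x} ->
  \int[mu]_(x in D) f x <= \int[mu]_(x in D) g x.
Proof.
move=> mD If Ig fg.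
have mf : measurable_fun D f by exact/measurable_EFinP/(measurable_int mu).
have mg : measurable_fun D g by exact/measurable_EFinP/(measurable_int mu).
have mM : measurable_fun D (fun x => Num.max (f x) (g x)).
  exact: measurable_maxr.
have gM : {ae mu, forall x, D x -> g x = Num.max (f x) (g x)}.
  by apply: filterS fg => x fgx Dx; apply/esym/max_idPr/fgx.
rewrite (ae_eq_Rintegral mD mg mM gM); apply: le_Rintegral => //.
- exact: ae_eq_integrable gM Ig.
- by move=> x _; rewrite le_max lexx.
Qed.

End almost_everywhere.

Section fubini_Rintegral.
Context d1 d2 (T1 : measurableType d1) (T2 : measurableType d2) (R : realType).
Variable m1 : {sigma_finite_measure set T1 -> \bar R}.
Variable m2 : {sigma_finite_measure set T2 -> \bar R}.
Variables (D : set T2) (mD : measurable D) (F : T2 -> T1 -> R).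
Hypothesis IF : (m1 \x m2)%E.-integrable ([set: T1] `*` D)
  (fun p => (F p.2 p.1)%:E).

Let Fh (p : T1 * T2) : \bar R :=
  ((fun p => (F p.2 p.1)%:E) \_ ([set: T1] `*` D)) p.

Let FhE w t : Fh (w, t) = if t \in D then (F t w)%:E else 0%E.
Proof.
rewrite /Fh patchE; congr (if _ then _ else _).
by apply/idP/idP; rewrite !inE //= => -[].
Qed.

Let IFh : (m1 \x m2)%E.-integrable [set: T1 * T2] Fh.
Proof.
rewrite /Fh; apply: (integrable_mkcond _ _).1 => //.
exact: measurableX.
Qed.

Lemma ae_integrable_section1 :
  {ae m2, forall t, D t -> m1.-integrable setT (EFin \o F t)}.
Proof.
apply: filterS (ae_integrable2 IFh) => t It Dt.
by apply: eq_integrable It => // w _; rewrite FhE mem_set.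
Qed.

Let integrable_G : m2.-integrable setT (fubini_G m1 Fh).
Proof.
have mFh := measurable_int _ IFh.
apply/integrableP; split; first exact: (measurable_fubini_G IFh).
apply: le_lt_trans ((integrable21ltyP m1 m2 mFh).1 IFh).
apply: ge0_le_integral => //.
- by apply: measurableT_comp => //; exact: (measurable_fubini_G IFh).
- apply: (measurable_fun_fubini_tonelli_G (abse \o Fh)) => //=.
  exact: measurableT_comp.
- move=> t _; apply: le_abse_integral => //.
  exact: measurableT_comp.
Qed.

Let integrable_fine d (T : measurableType d) (m : {measure set T -> \bar R})
    (G : T -> \bar R) : m.-integrable setT G ->
  m.-integrable setT (EFin \o fine \o G).
Proof.
move=> IG; have mG := measurable_int m IG.
apply: le_integrable IG => //; first exact/measurable_EFinP/measurableT_comp.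
by move=> x _ /=; case: (G x) => [r||] /=; rewrite ?lexx ?leey.
Qed.

Let integral_fine d (T : measurableType d) (m : {measure set T -> \bar R})
    (G : T -> \bar R) : m.-integrable setT G ->
  (\int[m]_x (fine (G x))%:E = \int[m]_x G x)%E.
Proof.
move=> IG; apply: ae_eq_integral => //.
- exact: measurable_int (integrable_fine IG).
- exact: measurable_int IG.
- by apply: filterS (integrable_ae measurableT IG) => x h /h; exact: fineK.
Qed.

Let G1E t : D t -> fubini_G m1 Fh t = (\int[m1]_w (F t w)%:E)%E.
Proof. by move=> Dt; apply: eq_integral => w _; rewrite FhE mem_set. Qed.

Let G1E0 t : ~ D t -> fubini_G m1 Fh t = 0%E.
Proof.
move=> Dt; rewrite /fubini_G; apply: integral0_eq => w _.
by rewrite FhE memNset.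
Qed.

Let F1E w : fubini_F m2 Fh w = (\int[m2]_(t in D) (F t w)%:E)%E.
Proof.
rewrite /fubini_F [RHS]integral_mkcond; apply: eq_integral => t _.
by rewrite FhE patchE.
Qed.

Let G1_patch :
  (EFin \o (fun t => \int[m1]_w F t w)) \_ D = EFin \o fine \o fubini_G m1 Fh.
Proof.
apply/funext => t; rewrite patchE; case: ifPn => [|/negP] tD /=.
  by rewrite G1E// -inE.
by rewrite G1E0// => Dt; apply: tD; rewrite inE.
Qed.

Lemma integrable_Rintegral1 :
  m2.-integrable D (EFin \o (fun t => \int[m1]_w F t w)).
Proof.
apply/integrable_mkcond => //; rewrite G1_patch.
exact: integrable_fine integrable_G.
Qed.

Lemma integrable_Rintegral2 :
  m1.-integrable setT (EFin \o (fun w => \int[m2]_(t in D) F t w)).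
Proof.
rewrite (_ : _ \o _ = EFin \o fine \o fubini_F m2 Fh); last first.
  by apply/funext => w /=; rewrite F1E.
exact: integrable_fine (integrable_fubini_F IFh).
Qed.

Lemma Fubini_Rintegral :
  \int[m1]_w (\int[m2]_(t in D) F t w) = \int[m2]_(t in D) (\int[m1]_w F t w).
Proof.
congr fine; rewrite [RHS]integral_mkcond.
under [RHS]eq_integral => t _.
  rewrite (_ : patch _ _ _ _ = (fine (fubini_G m1 Fh t))%:E); last first.
    by have /(congr1 (@^~ t)) := G1_patch.
  over.
under eq_integral do rewrite -/(Rintegral m2 D _) /Rintegral -F1E.
rewrite (integral_fine (integrable_fubini_F IFh)).
rewrite (integral_fine integrable_G).
by rewrite [LHS](Fubini IFh).
Qed.

End fubini_Rintegral.

#[local] Instance lebesgue_ae_filter (R : realType) :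
  Filter (nbhs (almost_everywhere (@lebesgue_measure R))).
Proof. by apply: ae_filter_ringOfSetsType. Qed.

#[local] Instance probability_ae_filter d (Om : measurableType d)
  (R : realType) (P : probability Om R) : Filter (nbhs (almost_everywhere P)).
Proof. by apply: ae_filter_ringOfSetsType. Qed.

Section translation.
Context (R : realType) (a : R).
Local Notation mu := (@lebesgue_measure R).

Let shift (t : measurableTypeR R) : measurableTypeR R := t - a.

Let measurable_shift : measurable_fun setT shift.
Proof. by apply: measurable_funB => //; exact: measurable_id. Qed.

Let nu : {measure set (measurableTypeR R) -> \bar R} :=
  measure_function_pushforward__canonical__measure_function_Measure
    mu measurable_shift.

Lemma lebesgue_measure_shift (A : set R) : measurable A ->
  mu ((fun t => t - a) @^-1` A) = mu A.
Proof.
move=> mA; rewrite -[LHS]/(nu A); apply/esym.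
apply: (@lebesgue_measure_unique R nu) => //= X [[x y]] /= _ <-.
rewrite /nu /pushforward /= /shift.
rewrite (_ : _ @^-1` _ = `]x + a, y + a]%classic); last first.
  by apply/seteqP; split => t /=; rewrite !in_itv /= lerBlDr ltrBrDr.
rewrite !lebesgue_measure_itv /= !lte_fin ltrD2r -!EFinB.
by rewrite opprD addrACA subrr addr0.
Qed.

Let nuE (A : set (measurableTypeR R)) : measurable A -> nu A = mu A.
Proof. by move=> mA; rewrite -[RHS]lebesgue_measure_shift. Qed.

Lemma ae_shift (Q : R -> Prop) :
  {ae mu, forall t, Q t} -> {ae mu, forall t, Q (t - a)}.
Proof.
move=> [N [mN N0 QN]]; exists ((fun t => t - a) @^-1` N); split.
- by rewrite -[X in measurable X]setTI; exact: measurable_shift.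
- by rewrite lebesgue_measure_shift.
- by move=> t Qt; apply: QN.
Qed.

Variables (f : R -> R) (If : mu.-integrable setT (EFin \o f)).

Lemma integrable_shift : mu.-integrable setT (fun t => (f (t - a))%:E).
Proof.
have mf := measurable_int mu If.
apply/integrableP; split.
  exact: (measurableT_comp mf measurable_shift).
have <- : (\int[nu]_t `|(f t)%:E| = \int[mu]_t `|(f (t - a))%:E|)%E.
  rewrite ge0_integral_pushforward//.
  exact: measurableT_comp.
rewrite (eq_measure_integral mu) => [|A mA _]; last exact: nuE.
by case/integrableP : If.
Qed.

Lemma Rintegral_shift : \int[mu]_t f (t - a) = \int[mu]_t f t.
Proof.
congr fine; transitivity (\int[nu]_t (f t)%:E)%E; last first.
  by apply: eq_measure_integral => A mA _; exact: nuE.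
rewrite (integral_pushforward measurable_shift (measurable_int _ If))//.
exact: integrable_shift.
Qed.

End translation.

Section delay.
Context (R : realType) (T delta : R) (F : R -> R).
Local Notation mu := (@lebesgue_measure R).
Hypotheses (delta0 : 0 <= delta) (IF : mu.-integrable `[0, T] (EFin \o F)).

Let k := F \_ `[0, T - delta].

Let sub0T : `[0, T - delta] `<=` `[0, T].
Proof. by apply: subset_itvl; rewrite bnd_simp gerBl. Qed.

Let Ik : mu.-integrable setT (EFin \o k).
Proof.
rewrite -restrict_EFin; apply: (integrable_mkcond _ _).1 => //.
exact: integrableS IF.
Qed.

Lemma integrable_delay :
  mu.-integrable `[0, T] (EFin \o (fun t => k (t - delta))).
Proof. by have := integrable_shift delta Ik; exact: integrableS. Qed.

Lemma Rintegral_delay :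
  {ae mu, forall s, 0 <= s <= T -> T - delta < s -> F s = 0} ->
  \int[mu]_(t in `[0, T]) k (t - delta) = \int[mu]_(s in `[0, T]) F s.
Proof.
move=> F0; rewrite Rintegral_mkcond [RHS]Rintegral_mkcond.
transitivity (\int[mu]_t k (t - delta)).
  apply: eq_Rintegral => t _; rewrite patchE; case: ifPn => // tT.
  rewrite /k patchE ifN//; apply: contra tT; rewrite !inE /= !in_itv /=.
  rewrite subr_ge0 lerD2r => /andP[dt ->]; rewrite andbT.
  by rewrite (le_trans _ dt).
rewrite (Rintegral_shift delta Ik); apply: ae_eq_Rintegral => //.
- by apply/measurable_EFinP; exact: measurable_int Ik.
- apply/measurable_EFinP; rewrite -restrict_EFin.
  by apply: measurable_int ((integrable_mkcond _ _).1 IF).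
apply: filterS F0 => s F0 _; rewrite /k !patchE.
case: ifPn => [/set_mem/sub0T sT|sT]; first by rewrite mem_set.
case: ifPn => // /set_mem /=; rewrite in_itv /= => s0T; rewrite F0//.
rewrite ltNge; apply: contra sT; rewrite inE /= in_itv /= => ->.
by case/andP : s0T => ->.
Qed.

End delay.

Section by_parts.
Context (R : realType) (T : R) (u v : R -> R).
Local Notation mu := (@lebesgue_measure R).
Hypothesis Iu : mu.-integrable `[0, T] (EFin \o u).
Hypothesis Iv : mu.-integrable `[0, T] (EFin \o v).

Let K (p : R * R) :=
  (u \_ `[0, T]) p.1 * (v \_ `[0, T]) p.2 * ((p.1 <= p.2)%R : nat)%:R.

Let IK : (mu \x mu)%E.-integrable [set: R * R] (EFin \o K).
Proof.
have Iu' : mu.-integrable setT (EFin \o (u \_ `[0, T])).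
  by rewrite -restrict_EFin; apply: (integrable_mkcond _ _).1.
have Iv' : mu.-integrable setT (EFin \o (v \_ `[0, T])).
  by rewrite -restrict_EFin; apply: (integrable_mkcond _ _).1.
have mu' : measurable_fun setT (u \_ `[0, T]).
  by apply/measurable_EFinP; exact: measurable_int Iu'.
have mv' : measurable_fun setT (v \_ `[0, T]).
  by apply/measurable_EFinP; exact: measurable_int Iv'.
pose K0 (p : R * R) := (u \_ `[0, T]) p.1 * (v \_ `[0, T]) p.2.
have mK0 : measurable_fun [set: R * R] K0.
  apply: measurable_funM.
    exact: (measurableT_comp mu' measurable_fst).
  exact: (measurableT_comp mv' measurable_snd).
have IK0 : (mu \x mu)%E.-integrable [set: R * R] (EFin \o K0).
  apply/integrable12ltyP; first exact/measurable_EFinP.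
  under eq_integral => x _.
    under eq_integral => y _ do rewrite /K0 /= normrM EFinM.
    rewrite ge0_integralZl//; last first.
      by apply/measurable_EFinP; exact: measurableT_comp.
    over.
  rewrite /= ge0_integralZr//; last 2 first.
  - by apply/measurable_EFinP; exact: measurableT_comp.
  - by apply: integral_ge0.
  apply: lte_mul_pinfty.
  - exact: integral_ge0.
  - by rewrite ge0_fin_numE ?integral_ge0//; case/integrableP : Iu'.
  - by case/integrableP : Iv'.
apply: le_integrable IK0 => //.
- apply/measurable_EFinP; apply: (measurable_funM mK0).
  rewrite (_ : (fun p => _) = \1_[set p : R * R | p.1 <= p.2]); last first.
    by apply/funext => p; rewrite indicE mem_setE.
  apply: measurable_indic; rewrite -[X in measurable X]setTI.
  exact: measurable_fun_le.
- move=> p _; rewrite !abse_EFin lee_fin /K normrM ler_piMr//.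
  by case: (p.1 <= p.2)%R; rewrite ?normr1 ?normr0.
Qed.

Let K1E t : \int[mu]_s K (t, s) =
  ((fun t => u t * \int[mu]_(s in `[t, T]) v s) \_ `[0, T]) t.
Proof.
rewrite patchE; case: ifPn => [|/negP] tT; last first.
  rewrite (_ : (fun s => K (t, s)) = cst 0).
    by rewrite /Rintegral integral0.
  by apply/funext => s; rewrite /K /= patchE (negbTE (introN idP tT)) !mul0r.
have t0T : 0 <= t <= T by move: tT; rewrite inE /= in_itv.
have Ivt : mu.-integrable setT (EFin \o (v \_ `[t, T])).
  rewrite -restrict_EFin; apply: (integrable_mkcond _ _).1 => //.
  apply: integrableS Iv => //; apply: subset_itvr.
  by rewrite bnd_simp; case/andP : t0T.
rewrite (_ : (fun s => K (t, s)) = (fun s => u t * (v \_ `[t, T]) s)).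
  by rewrite RintegralZl// [in RHS]Rintegral_mkcond.
apply/funext => s; rewrite /K /= !patchE tT -mulrA; congr (_ * _).
rewrite !mem_setE !in_itv /=; case/andP : t0T => t0 _.
have [ts|] := leP t s; last by rewrite mulr0.
by rewrite (le_trans t0 ts) mulr1.
Qed.

Let K2E s : \int[mu]_t K (t, s) =
  ((fun s => (\int[mu]_(t in `[0, s]) u t) * v s) \_ `[0, T]) s.
Proof.
rewrite patchE; case: ifPn => [|/negP] sT; last first.
  rewrite (_ : (fun t => K (t, s)) = cst 0).
    by rewrite /Rintegral integral0.
  apply/funext => t; rewrite /K /= [(v \_ _) s]patchE.
  by rewrite (negbTE (introN idP sT)) mulr0 mul0r.
have s0T : 0 <= s <= T by move: sT; rewrite inE /= in_itv.
have Ius : mu.-integrable setT (EFin \o (u \_ `[0, s])).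
  rewrite -restrict_EFin; apply: (integrable_mkcond _ _).1 => //.
  apply: integrableS Iu => //; apply: subset_itvl.
  by rewrite bnd_simp; case/andP : s0T.
rewrite (_ : (fun t => K (t, s)) = (fun t => (u \_ `[0, s]) t * v s)).
  by rewrite RintegralZr// [in RHS]Rintegral_mkcond.
apply/funext => t; rewrite /K /= !patchE sT mulrAC; congr (_ * _).
rewrite !mem_setE !in_itv /=; case/andP : s0T => _ sT'.
have [ts|] := leP t s; last by rewrite andbF mulr0.
by rewrite (le_trans ts sT') mulr1.
Qed.

Let IK' : (mu \x mu)%E.-integrable ([set: R] `*` [set: R])
   (fun p => ((fun t s => K (s, t)) p.2 p.1)%:E).
Proof. by rewrite setXTT; apply: eq_integrable IK => // -[]. Qed.

Lemma integrable_mul_tail_integral : mu.-integrable `[0, T]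
  (EFin \o (fun t => u t * \int[mu]_(s in `[t, T]) v s)).
Proof.
apply/integrable_mkcond => //; rewrite restrict_EFin.
have := integrable_Rintegral2 measurableT IK'.
by apply: eq_integrable => // t _ /=; rewrite K1E.
Qed.

Lemma integrable_primitive_mul : mu.-integrable `[0, T]
  (EFin \o (fun s => (\int[mu]_(t in `[0, s]) u t) * v s)).
Proof.
apply/integrable_mkcond => //; rewrite restrict_EFin.
have := integrable_Rintegral1 measurableT IK'.
by apply: eq_integrable => // t _ /=; rewrite K2E.
Qed.

Lemma Rintegral_mul_tail_integral :
  \int[mu]_(t in `[0, T]) (u t * \int[mu]_(s in `[t, T]) v s) =
  \int[mu]_(s in `[0, T]) ((\int[mu]_(t in `[0, s]) u t) * v s).
Proof.
rewrite [LHS]Rintegral_mkcond [RHS]Rintegral_mkcond.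
have := Fubini_Rintegral measurableT IK'.
under eq_Rintegral => t _ do rewrite K1E.
by under [X in _ = X]eq_Rintegral => s _ do rewrite K2E.
Qed.

End by_parts.

Section square_integrable.
Context d (Om : measurableType d) (R : realType) (P : probability Om R).
Implicit Types (xi eta : {RV P >-> R}).

Lemma Lfun2P (f : Om -> R) : f \in Lfun P 2%:E <->
  measurable_fun setT f /\ P.-integrable setT (fun w => (f w ^+ 2)%:E).
Proof.
split=> [f2|[mf /integrableP[_ If2]]].
  split; last exact: Lfun2_integrable_sqr.
  by move: f2; rewrite inE => /andP[/[!inE]].
rewrite inE; apply/andP; split; rewrite inE //= /finite_norm unlock.
rewrite poweR_lty//; apply: le_lt_trans If2.
under [leRHS]eq_integral => w _.
  rewrite gee0_abs ?lee_fin ?sqr_ge0// -[(f w ^+ 2)]ger0_norm ?sqr_ge0//.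
  rewrite normrX -powR_mulrn//.
  over.
by [].
Qed.

Lemma Lfun2_ae_eq (f g : Om -> R) : measurable_fun setT g ->
  {ae P, forall w, f w = g w} -> f \in Lfun P 2%:E -> g \in Lfun P 2%:E.
Proof.
move=> mg fg /Lfun2P[mf If]; apply/Lfun2P; split=> //.
apply: (ae_eq_integrable measurableT _ _ If); first exact: measurable_funX.
by apply: filterS fg => w fgw _; rewrite fgw.
Qed.

Lemma has_law_Lfun_Sub xi (xi2 : (xi : Om -> R) \in Lfun P 2%:E) :
  has_law (P := P) (Lfun_Sub (lee1n 2) xi2 : L2 P) (distribution P xi).
Proof. by []. Qed.

Lemma P2_distribution xi :
  (xi : Om -> R) \in Lfun P 2%:E -> P2 (distribution P xi).
Proof.
move=> /Lfun2P[_ /integrableP[mX2]]; rewrite /P2.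
rewrite ge0_integral_distribution//; last by move=> x; rewrite lee_fin sqr_ge0.
apply: le_lt_trans; apply: ge0_le_integral => //.
- by move=> w _; rewrite /= lee_fin sqr_ge0.
- exact: measurableT_comp.
- by move=> w _; exact: lee_abs.
- by apply/measurable_EFinP; exact: measurable_funX.
Qed.

End square_integrable.

Section fbm_calculus.
Context d (Om : measurableType d) (R : realType) (P : probability Om R).
Context (T h : R) (B : R -> {RV P >-> R}).

Lemma divergence_mean0 (u : R -> Om -> R) : dom_divergence T h B u ->
  [/\ divergence T h B u \in Lfun P 2%:E,
      P.-integrable setT (EFin \o divergence T h B u) &
      \int[P]_w divergence T h B u w = 0].
Proof.
move=> /(xgetPex (fun=> 0)); rewrite -/(divergence T h B u).
set D := divergence T h B u => -[_ _ D2 _ Dp].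
split=> //.
  by apply/Lfun1_integrable; apply: Lfun_subset12 D2; exact: fin_num_measure.
pose t (i : 'I_0) : R := 0.
have [|_] := Dp 0%N t (mpoly.mpolyC 0 1); first by case.
rewrite /poly_functional.
under eq_Rintegral do rewrite mpoly.mevalC mul1r.
move=> ->; rewrite (_ : (fun w => _) = cst 0) ?Rintegral_cst// ?mul0r//.
apply/funext => w /=; rewrite /inner /=.
rewrite (_ : malliavin_deriv _ _ _ _ = cst 0); last first.
  by apply/funext => r; rewrite /malliavin_deriv big_ord0.
rewrite [LHS](_ : _ = \int[lebesgue_measure]_(r in `[0, T]) 0).
  by rewrite /Rintegral integral0.
apply: eq_Rintegral => r _ /=.
under eq_Rintegral => s _ do rewrite mulr0 mul0r.
by rewrite /Rintegral integral0.
Qed.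

Lemma condexp_mean (t : R) (D C : Om -> R) : is_condexp B t D C ->
  \int[P]_w C w = \int[P]_w D w.
Proof.
move=> [_ _ _]; apply.
exact: (@measurableT _ (g_sigma_algebraType _)).
Qed.

Lemma filtration_measurable_measurable (t : R) (D : Om -> R) :
  filtration_measurable B t D -> measurable_fun setT D.
Proof.
move=> mD _ A mA; rewrite setTI.
have := mD A mA; apply: smallest_sub => //.
  exact: sigma_algebra_measurable.
by move=> X [s _ [Y mY <-]]; exact: measurable_funPT.
Qed.

End fbm_calculus.

Section constrained_maximum.
Context (R : realType) (U : set R).

Lemma derivable_in_addc (F : R -> R) (c u : R) :
  derivable_in U (fun s => F s + c) u = derivable_in U F u.
Proof.
rewrite /derivable_in; under eq_fun do rewrite opprD addrACA subrr addr0.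
by [].
Qed.

Lemma derive_in_le0_max (F : R -> R) (u v : R) : open U \/ is_interval U ->
  U u -> U v -> derivable_in U F u -> (forall s, U s -> F s <= F u) ->
  derive_in U F u * (v - u) <= 0.
Proof.
move=> UU Uu Uv; rewrite /derivable_in /derive_in.
set q := fun s => _; set l := lim _ => ql Fmax.
have [->|vu] := eqVneq v u; first by rewrite subrr mulr0.
have vu0 : 0 < `|v - u| by rewrite normr_gt0 subr_eq0.
have [r r0 Ur] : exists2 r, 0 < r & forall e, 0 < e <= r -> U (u + e * (v - u)).
  case: UU => [oU|iU].
    have /nbhs_ballP[r /= r0 rU] := open_nbhs_nbhs (conj oU Uu).
    exists (r / 2 / `|v - u|); first by rewrite divr_gt0// divr_gt0.
    move=> e /andP[e0 er]; apply: rU; rewrite /ball /= opprD addNKr normrN.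
    rewrite normrM gtr0_norm// -ltr_pdivlMr//.
    apply: (le_lt_trans er); rewrite ltr_pM2r ?invr_gt0//.
    by rewrite gtr_pMr// invf_lt1// ltr1n.
  exists 1 => // e /andP[e0 e1].
  have [uv|vu'] := leP u v.
    apply: (iU u v) => //; apply/andP; split; first by nra.
    nra.
  apply: (iU v u) => //; apply/andP; split; nra.
rewrite leNgt; apply/negP => lvu.
have : \forall s \near within U u^', 0 < q s * (v - u).
  have ql' : q s * (v - u) @[s --> within U u^'] --> l * (v - u).
    exact: (cvgM ql (cvg_cst _)).
  exact: (cvgr_gt _ ql').
rewrite near_withinE => /nbhs_ballP[e /= e0 eq].
pose s := Num.min r (e / 2 / `|v - u|).
have s0 : 0 < s by rewrite lt_min r0 !divr_gt0.
have sr : s <= r by rewrite ge_min lexx.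
have se : s * `|v - u| < e.
  rewrite -ltr_pdivlMr//; apply: (@le_lt_trans _ _ (e / 2 / `|v - u|)).
    by rewrite ge_min lexx orbT.
  by rewrite ltr_pM2r ?invr_gt0// gtr_pMr// invf_lt1// ltr1n.
have Us : U (u + s * (v - u)) by apply: Ur; rewrite s0.
have : 0 < q (u + s * (v - u)) * (v - u).
  apply: (eq (u + s * (v - u))) => //.
    by rewrite /ball /= opprD addNKr normrN normrM gtr0_norm.
  by rewrite -subr_eq0 addrAC subrr add0r mulf_neq0 ?subr_eq0// gt_eqF.
rewrite /q addrAC subrr add0r invfM mulrA -mulrA mulVf ?subr_eq0// mulr1.
by rewrite pmulr_lgt0 ?invr_gt0// subr_gt0 ltNge Fmax.
Qed.

End constrained_maximum.

Section measure_derivative.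
Context d (Om : measurableType d) (R : realType) (P : probability Om R).
Variables (xi : {RV P >-> R}) (D : R -> R).
Hypothesis D2 : D \in Lfun (distribution P xi) 2%:E.

Let measurable_D : measurable_fun setT D.
Proof. by move/Lfun2P : D2 => []. Qed.

Let measurable_Dxi : measurable_fun setT (D \o xi).
Proof. exact: measurableT_comp. Qed.

Lemma integrable_Lfun2_comp : P.-integrable setT (EFin \o (D \o xi)).
Proof.
have /Lfun1_integrable/integrableP[mD ID] : D \in Lfun (distribution P xi) 1.
  by apply: Lfun_subset12 D2; exact: fin_num_measure.
apply/integrableP; split; first exact/measurable_EFinP.
apply: le_lt_trans ID; rewrite ge0_integral_distribution//.
exact: measurableT_comp.
Qed.

Lemma Rintegral_mderiv_shift (eta : {RV P >-> R}) (c : R) :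
  {ae P, forall w, eta w = xi w + c} ->
  \int[P]_w (D (xi w) * (eta w - xi w)) = c * \int[P]_w D (xi w).
Proof.
move=> etaE; rewrite -RintegralZl//; last exact: integrable_Lfun2_comp.
apply: ae_eq_Rintegral => //.
- by apply: measurable_funM => //; exact: measurable_funB.
- exact: measurable_funM.
- by apply: filterS etaE => w -> _; rewrite [xi w + c]addrC addrK mulrC.
Qed.

Lemma Rintegral_mderiv0 (eta : {RV P >-> R}) :
  {ae P, forall w, D (xi w) = 0} ->
  \int[P]_w (D (xi w) * (eta w - xi w)) = 0.
Proof.
move=> D0; transitivity (\int[P]_w (0 : R)); last first.
  by rewrite /Rintegral integral0.
apply: ae_eq_Rintegral => //.
- by apply: measurable_funM => //; exact: measurable_funB.
- by apply: filterS D0 => w -> _; rewrite mul0r.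
Qed.

End measure_derivative.

Section state.
Context d (Om : measurableType d) (R : realType) (P : probability Om R).
Context (T delta h : R) (B : R -> {RV P >-> R}).
Context (b : R -> law R -> law R -> law R -> R) (sigma x0 : R -> R).
Local Notation mu := (@lebesgue_measure R).
Local Notation is_state := (is_state T delta h B b sigma x0).
Implicit Types (u X : R -> {RV P >-> R}) (t : R).

Definition drift_along u X t : R :=
  b t (distribution P (X t)) (distribution P (X (t - delta)))
    (distribution P (u t)).

Lemma is_state_Lfun2 u X t : is_state u X -> - delta <= t <= T ->
  (X t : Om -> R) \in Lfun P 2%:E.
Proof.
move=> [Xpast _ XE] /andP[dt tT]; have [t0|t0] := leP t 0.
  apply: (@Lfun2_ae_eq _ _ _ _ (cst (x0 t))) => //.
    by have := Xpast t; rewrite dt t0 => /(_ isT); apply: filterS => w ->.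
  exact: Lfun_cst.
have [|sig Xt] := XE t; first by rewrite (ltW t0).
set c := x0 0 + \int[mu]_(s in `[0, t]) drift_along u X s.
set D := divergence T h B _ in Xt.
have [D2 _ _] := divergence_mean0 sig.
have cD2 : cst c + D \in Lfun P 2%:E.
  by apply: (Lfun_addr_closed P (lee1n 2)).2 => //; exact: Lfun_cst.
by apply: Lfun2_ae_eq cD2 => //; apply: filterS Xt => w ->.
Qed.

Definition state_gap u X u' X' t : R :=
  \int[mu]_(s in `[0, t]) (drift_along u X s - drift_along u' X' s).

Lemma is_stateB u X u' X' t : is_state u X -> is_state u' X' ->
  - delta <= t <= T ->
  {ae P, forall w, X t w = X' t w + state_gap u X u' X' t}.
Proof.
move=> [Xpast Ib XE] [Xpast' Ib' XE'] /andP[dt tT].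
have [t0|t0] := ltP t 0.
  have tp : - delta <= t <= 0 by rewrite dt ltW.
  rewrite /state_gap set_itv_ge -?ltNge ?bnd_simp//.
  rewrite Rintegral_set0.
  by near=> w; rewrite addr0 (near (Xpast t tp) w)// (near (Xpast' t tp) w).
have t0T : 0 <= t <= T by rewrite t0.
have sub0t : `[0, t] `<=` `[0, T].
  by apply: subset_itvl; rewrite bnd_simp.
rewrite /state_gap RintegralB//; last 2 first.
- exact: integrableS Ib.
- exact: integrableS Ib'.
near=> w; rewrite (near (XE t t0T).2 w)// (near (XE' t t0T).2 w)//.
rewrite /drift_along; lra.
Unshelve. all: by end_near.
Qed.

End state.

(* [measurable_itv] is about the sigma-algebra of [R], not [measurableTypeR R],
   the two being only convertible. *)
Lemma measurable_segment (R : realType) (s t : R) :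
  measurable (`[s, t] : set (measurableTypeR R)).
Proof. exact: measurable_itv. Qed.

Section adjoint.
Context d (Om : measurableType d) (R : realType) (P : probability Om R).
Context (T delta h : R) (B : R -> {RV P >-> R}).
Context (b : R -> law R -> law R -> law R -> R) (sigma : R -> R).
Context (f : Om -> R -> R -> R -> law R -> law R -> R -> R).
Context (g : Om -> R -> law R -> R).
Context (dH1 dH2 :
  Om -> R -> R -> R -> R -> law R -> law R -> law R -> R -> R -> R -> R).
Context (dg : Om -> R -> law R -> R -> R).
Variables (u X : R -> {RV P >-> R}) (Y Z : R -> Om -> R).
Local Notation mu := (@lebesgue_measure R).
Local Notation hx := (hamiltonian_x delta b sigma f u X Y Z).
Local Notation hxb := (hamiltonian_xb delta b sigma f u X Y Z).
Local Notation m1 := (mfield1 delta dH1 u X Y Z).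
Local Notation m2 := (mfield2 T delta dH2 u X Y Z).
Local Notation mT := (mfieldT T dg X).

Hypothesis adj :
  adjoint_solution T delta h B b sigma f g dH1 dH2 dg u X Y Z.

Definition mean_present t : R :=
  \int[P]_w hx t w + \int[P]_w (\int[P]_w' m1 t w' w).

Definition mean_delayed t : R :=
  \int[P]_w (hxb (t + delta) w * chi T delta t)
  + \int[P]_w (\int[P]_w' m2 t w' w).

Lemma mean_delayed0 t : T - delta < t -> mean_delayed t = 0.
Proof.
move=> tT; have chi0 : chi T delta t = 0.
  rewrite /chi indicE memNset//= in_itv /= => /andP[_].
  by rewrite leNgt tT.
have int0 (F : Om -> R) : \int[P]_w (F w * 0) = 0.
  by under eq_Rintegral do rewrite mulr0; rewrite /Rintegral integral0.
rewrite /mean_delayed /mfield2 chi0 int0 add0r.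
by under eq_Rintegral do rewrite int0; rewrite /Rintegral integral0.
Qed.

Lemma integrable_mean_present :
  mu.-integrable `[0, T] (EFin \o mean_present).
Proof.
case: adj => _ _ _ [C1 [C2 [_ _ [Ihx _ Im1 _] _ _]]].
have m0T := measurable_segment 0 T.
have := integrableD m0T (integrable_Rintegral1 m0T Ihx)
  (integrable_Rintegral1 m0T Im1).
by apply: eq_integrable.
Qed.

Lemma adjoint_section_integrable : {ae mu, forall t, 0 <= t <= T ->
  [/\ P.-integrable setT (EFin \o hx t),
      (P \x P)%E.-integrable setT (fun p => (m1 t p.1 p.2)%:E),
      P.-integrable setT (fun w => (hxb (t + delta) w * chi T delta t)%:E) &
      (P \x P)%E.-integrable setT (fun p => (m2 t p.1 p.2)%:E)]}.
Proof.
case: adj => _ _ _ [C1 [C2 [PP12 CE [Ihx _ _ _] _ _]]].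
have hxt := ae_integrable_section1 (@measurable_segment _ _ _) Ihx.
move: PP12 CE hxt; apply: filterS3 => t PP CE hxt t0T.
have [PP1 PP2] := PP t0T; have [[Ixb _ _ _] _] := CE t0T.
by split=> //; apply: hxt; rewrite /= in_itv.
Qed.

Lemma integrable_adjoint_terminal :
  P.-integrable setT (EFin \o adjoint_terminal T g dg X).
Proof.
case: adj => _ _ [Ig IT] _.
have IT' : (P \x P)%E.-integrable ([set: Om] `*` [set: Om])
    (fun p => ((fun w w' => mT w' w) p.2 p.1)%:E).
  by rewrite setXTT.
have := integrableD measurableT Ig
  (integrable_Rintegral1 (F := fun w w' => mT w' w) measurableT IT').
by apply: eq_integrable.
Qed.

Lemma adjoint_terminal_mean : 0 <= T -> \int[P]_w Y T w =
  \int[P]_w (derive1 (fun s => g w s (distribution P (X T))) (X T w))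
  + \int[P]_w (\int[P]_w' mT w' w).
Proof.
move=> T0; have It := integrable_adjoint_terminal.
case: adj => -[mY aY] _ [Ig IT] [C1 [C2 [_ _ [_ _ _ _] YTE Yt]]].
have IT' : (P \x P)%E.-integrable ([set: Om] `*` [set: Om])
    (fun p => ((fun w w' => mT w' w) p.2 p.1)%:E).
  by rewrite setXTT.
rewrite -RintegralD//; last first.
  exact: (integrable_Rintegral1 (F := fun w w' => mT w' w) measurableT IT').
apply: ae_eq_Rintegral => //.
- by apply: filtration_measurable_measurable (aY T _); rewrite T0 lexx.
- by apply/measurable_EFinP; exact: measurable_int It.
- by apply: filterS YTE => w ->.
Qed.

Lemma adjoint_mean : 0 <= T -> exists C : R -> R,
  [/\ mu.-integrable `[0, T] (EFin \o C),
      {ae mu, forall t, 0 <= t <= T -> C t = mean_delayed t} &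
      forall t, 0 <= t <= T -> P.-integrable setT (EFin \o Y t) /\
        \int[P]_w Y t w = \int[P]_w Y T w
          + \int[mu]_(s in `[t, T]) (mean_present s + C s)].
Proof.
move=> T0; have It := integrable_adjoint_terminal.
have Ipres := integrable_mean_present.
case: adj => -[_ aY] _ _ [C1 [C2 [_ CE [Ihx IC1 Im1 IC2] YTE Yt]]].
have mY t : 0 <= t <= T -> measurable_fun setT (Y t).
  by move=> t0T; exact: filtration_measurable_measurable (aY t t0T).
have IYT : P.-integrable setT (EFin \o Y T).
  apply: (ae_eq_integrable measurableT _ _ It).
    by apply: mY; rewrite lexx T0.
  by apply: filterS YTE => w ->.
have m0T := measurable_segment 0 T.
pose C t := \int[P]_w C1 t w + \int[P]_w C2 t w.
have IC : mu.-integrable `[0, T] (EFin \o C).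
  have := integrableD m0T (integrable_Rintegral1 m0T IC1)
    (integrable_Rintegral1 m0T IC2).
  exact: eq_integrable.
exists C; split => //.
  apply: filterS CE => t CE t0T; have [CE1 CE2] := CE t0T.
  by rewrite /C (condexp_mean CE1) (condexp_mean CE2).
move=> t t0T.
pose dr s w := hx s w + C1 s w + \int[P]_w' m1 s w' w + C2 s w.
have Idr : integrable_process P T dr.
  have mS : measurable (strip T : set (Om * measurableTypeR R)).
    exact: measurableX.
  have := integrableD mS (integrableD mS (integrableD mS Ihx IC1) Im1) IC2.
  exact: eq_integrable.
have subtT : `[t, T] `<=` `[0, T].
  by apply: subset_itvr; rewrite bnd_simp; case/andP : t0T.
have Idrt : (P \x mu)%E.-integrable ([set: Om] `*` `[t, T])
    (fun p => (dr p.2 p.1)%:E).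
  apply: integrableS Idr; [exact: measurableX|exact: measurableX|].
  by move=> [w s] [_] /subtT.
have Itail := integrable_Rintegral2 (@measurable_segment _ _ _) Idrt.
have [divZ YtE] := Yt t t0T.
have [_ Idiv div0] := divergence_mean0 divZ.
set div := divergence _ _ _ _ in YtE Idiv div0.
pose G w := Y T w + \int[mu]_(s in `[t, T]) dr s w - div w.
have IYTt := integrableD measurableT IYT Itail.
have IG : P.-integrable setT (EFin \o G).
  have := integrableB measurableT IYTt Idiv.
  exact: eq_integrable.
have GE : {ae P, forall w, setT w -> G w = Y t w}.
  by apply: filterS YtE => w -> _.
split; first exact: ae_eq_integrable (mY t t0T) GE IG.
have -> : \int[P]_w Y t w = \int[P]_w G w.
  apply/esym; apply: ae_eq_Rintegral GE => //; last exact: mY.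
  by apply/measurable_EFinP; exact: measurable_int IG.
rewrite /G RintegralB// RintegralD// div0 subr0; congr (_ + _).
rewrite (Fubini_Rintegral (@measurable_segment _ _ _) Idrt).
have mtT := measurable_segment t T.
apply: ae_eq_Rintegral => //.
- apply/measurable_EFinP.
  exact: measurable_int (integrable_Rintegral1 mtT Idrt).
- have := integrableD mtT (integrableS m0T mtT subtT Ipres)
    (integrableS m0T mtT subtT IC).
  by move=> /measurable_int/measurable_EFinP.
have Shx := ae_integrable_section1 m0T Ihx.
have SC1 := ae_integrable_section1 m0T IC1.
have Sm1 := ae_integrable_section1 m0T Im1.
have SC2 := ae_integrable_section1 m0T IC2.
near=> s => /subtT s0T.
have hxs : P.-integrable setT (EFin \o hx s) by apply: (near Shx s).
have C1s : P.-integrable setT (EFin \o C1 s) by apply: (near SC1 s).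
have m1s : P.-integrable setT (EFin \o (fun w => \int[P]_w' m1 s w' w)).
  by apply: (near Sm1 s).
have C2s : P.-integrable setT (EFin \o C2 s) by apply: (near SC2 s).
have S12 := integrableD measurableT hxs C1s.
have S123 := integrableD measurableT S12 m1s.
rewrite /dr RintegralD// RintegralD// RintegralD// /mean_present /C; lra.
Unshelve. all: by end_near.
Qed.

End adjoint.

Section symmetric_expectation.
Context d (Om : measurableType d) (R : realType) (P : probability Om R).
Variable K : Om -> Om -> R.
Hypothesis IK : (P \x P)%E.-integrable setT (fun p => (K p.1 p.2)%:E).

Let IK' : (P \x P)%E.-integrable ([set: Om] `*` [set: Om])
  (fun p => ((fun w' w => K w w') p.2 p.1)%:E).
Proof. by rewrite setXTT. Qed.

Lemma integrable_partial_expectation :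
  P.-integrable setT (EFin \o (fun w => \int[P]_w' K w w')).
Proof.
exact: (integrable_Rintegral2 (F := fun w' w => K w w') measurableT IK').
Qed.

Lemma iterated_expectationC :
  \int[P]_w (\int[P]_w' K w w') = \int[P]_w (\int[P]_w' K w' w).
Proof. exact: (Fubini_Rintegral (F := fun w' w => K w w') measurableT IK'). Qed.

End symmetric_expectation.

Section optimality.
Context d (Om : measurableType d) (R : realType) (P : probability Om R).
Context (T delta h : R) (U : set R) (B : R -> {RV P >-> R}).
Hypotheses (hdelta : 0 < delta) (hU : open U \/ is_interval U).
Context (b : R -> law R -> law R -> law R -> R) (sigma x0 : R -> R).
Context (f : Om -> R -> R -> R -> law R -> law R -> R -> R).
Context (g : Om -> R -> law R -> R).
Context (C : R) (hC1 : coefficients_C1 T U f g C).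
Context (dH1 dH2 dH3 :
  Om -> R -> R -> R -> R -> law R -> law R -> law R -> R -> R -> R -> R).
Context (dg : Om -> R -> law R -> R -> R).
Hypothesis hdH : are_mderivs P T U b sigma f g dH1 dH2 dH3 dg.
Variables (us Xs u X : R -> {RV P >-> R}) (Y Z : R -> Om -> R).
Hypotheses (hXs : is_state T delta h B b sigma x0 us Xs)
  (hX : is_state T delta h B b sigma x0 u X).
Local Notation mu := (@lebesgue_measure R).
Local Notation hx := (hamiltonian_x delta b sigma f us Xs Y Z).
Local Notation hxb := (hamiltonian_xb delta b sigma f us Xs Y Z).
Local Notation m1 := (mfield1 delta dH1 us Xs Y Z).
Local Notation m2 := (mfield2 T delta dH2 us Xs Y Z).
Local Notation mT := (mfieldT T dg Xs).
Local Notation gap := (state_gap delta b u X us Xs).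
Local Notation "'law_' xi" := (distribution P xi : law R)
  (at level 10, xi at level 8).

Section running.
Variable t : R.
Hypotheses (t0T : 0 <= t <= T).
Hypotheses (Uus : forall w, U (us t w)) (Uu : forall w, U (u t w)).
Hypotheses (us2 : (us t : Om -> R) \in Lfun P 2%:E)
  (u2 : (u t : Om -> R) \in Lfun P 2%:E).
Hypothesis concaveH : {ae P, forall w,
  concave_H P U
    (fun x xb v m1 m2 m3 =>
       hamiltonian b sigma f w t x xb v m1 m2 m3 (Y t w) (Z t w))
    (fun x xb v m1 m2 m3 => dH1 w t x xb v m1 m2 m3 (Y t w) (Z t w))
    (fun x xb v m1 m2 m3 => dH2 w t x xb v m1 m2 m3 (Y t w) (Z t w))
    (fun x xb v m1 m2 m3 => dH3 w t x xb v m1 m2 m3 (Y t w) (Z t w))}.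
Hypothesis maxH : {ae P, forall w,
  let Ht v := hamiltonian b sigma f w t
    (Xs t w) (Xs (t - delta) w) v
    (law_ (Xs t)) (law_ (Xs (t - delta))) (law_ (us t)) (Y t w) (Z t w) in
  (Ht (us t w))%:E = ereal_sup [set (Ht v)%:E | v in U]}.
Hypothesis dH30 : {ae P, forall w, {ae P, forall w',
  dH3 w t (Xs t w) (Xs (t - delta) w) (us t w)
    (law_ (Xs t)) (law_ (Xs (t - delta))) (law_ (us t))
    (Y t w) (Z t w) (us t w') = 0}}.

Lemma running_cost_gap : {ae P, forall w,
  running_cost delta f u X t w - running_cost delta f us Xs t w
  + (drift_along delta b u X t - drift_along delta b us Xs t) * Y t w
  <= gap t * (hx t w + \int[P]_w' m1 t w w')
   + gap (t - delta) * (hxb t w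
       + \int[P]_w' along delta us Xs Y Z dH2 t w (Xs (t - delta) w'))}.
Proof.
have tT : - delta <= t <= T.
  by case/andP : t0T => t0 ->; rewrite andbT (le_trans _ t0)// oppr_le0 ltW.
have tdT : - delta <= t - delta <= T.
  by case/andP : t0T => t0 tT'; rewrite -[leLHS]add0r lerD2r t0/= lerBlDr
    (le_trans tT')// lerDl ltW.
have Xs2 := is_state_Lfun2 hXs tT.
have X2 := is_state_Lfun2 hX tT.
have Xsd2 := is_state_Lfun2 hXs tdT.
have Xd2 := is_state_Lfun2 hX tdT.
have gapt := is_stateB hX hXs tT.
have gapd := is_stateB hX hXs tdT.
have FP : Filter (nbhs (almost_everywhere P)) by exact _.
have gaps := @filterI _ _ FP _ _ gapt gapd.
have opt := @filterI _ _ FP _ _ maxH dH30.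
apply: filterS3 gaps opt concaveH => w [Xw Xdw] [maxw dH30w] concw.
have [D1 D2 D3] := hdH.1 w t (Xs t w) (Xs (t - delta) w) (us t w)
  (law_ (Xs t)) (law_ (Xs (t - delta))) (law_ (us t)) (Y t w) (Z t w)
  t0T (Uus w) (P2_distribution Xs2) (P2_distribution Xsd2)
  (P2_distribution us2).
have I1 : _ = gap t * \int[P]_w' m1 t w w' :=
  Rintegral_mderiv_shift D1.1 gapt.
pose m2' w' := along delta us Xs Y Z dH2 t w (Xs (t - delta) w').
have I2 : _ = gap (t - delta) * \int[P]_w' m2' w' :=
  Rintegral_mderiv_shift D2.1 gapd.
have I3 := Rintegral_mderiv0 D3.1 (u t) dH30w.
set A1 := LHS in I1; set A2 := LHS in I2; set A3 := LHS in I3.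
pose Ht v := hamiltonian b sigma f w t (Xs t w) (Xs (t - delta) w) v
  (law_ (Xs t)) (law_ (Xs (t - delta))) (law_ (us t)) (Y t w) (Z t w).
have Hu : derive_in U Ht (us t w) * (u t w - us t w) <= 0.
  apply: derive_in_le0_max => //.
    rewrite /Ht /hamiltonian !derivable_in_addc.
    have [fC _] := hC1.1 w t _ _ t0T (P2_distribution Xs2)
      (P2_distribution Xsd2).
    by have [_ _ ? _] := fC (Xs t w) (Xs (t - delta) w) _ (Uus w).
  move=> s Us; rewrite -lee_fin.
  rewrite [leRHS]maxw; apply: ereal_sup_ubound.
  by exists s.
have conc := concw (Xs t w) (Xs (t - delta) w) (us t w)
  (X t w) (X (t - delta) w) (u t w) _ _ _ _ _ _
  (Lfun_Sub (lee1n 2) Xs2) (Lfun_Sub (lee1n 2) Xsd2) (Lfun_Sub (lee1n 2) us2)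
  (Lfun_Sub (lee1n 2) X2) (Lfun_Sub (lee1n 2) Xd2) (Lfun_Sub (lee1n 2) u2)
  (Uus w) (Uu w)
  (has_law_Lfun_Sub Xs2) (has_law_Lfun_Sub Xsd2) (has_law_Lfun_Sub us2)
  (has_law_Lfun_Sub X2) (has_law_Lfun_Sub Xd2) (has_law_Lfun_Sub u2).
pose Ht_u := hamiltonian b sigma f w t (X t w) (X (t - delta) w) (u t w)
  (law_ (X t)) (law_ (X (t - delta))) (law_ (u t)) (Y t w) (Z t w).
have {}conc : Ht_u - Ht (us t w) - hx t w * (X t w - Xs t w)
    - hxb t w * (X (t - delta) w - Xs (t - delta) w)
    - derive_in U Ht (us t w) * (u t w - us t w)
    - A1 - A2 - A3 <= 0 := conc.
rewrite I1 I2 I3 in conc.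
move: conc Hu; rewrite Xw Xdw /Ht_u /Ht /hamiltonian /running_cost /drift_along.
lra.
Qed.

Lemma running_cost_gap_mean :
  P.-integrable setT (EFin \o running_cost delta f u X t) ->
  P.-integrable setT (EFin \o running_cost delta f us Xs t) ->
  P.-integrable setT (EFin \o Y t) ->
  P.-integrable setT (EFin \o hx t) ->
  (P \x P)%E.-integrable setT (fun p => (m1 t p.1 p.2)%:E) ->
  (delta <= t ->
    P.-integrable setT
      (fun w => (hxb (t - delta + delta) w * chi T delta (t - delta))%:E) /\
    (P \x P)%E.-integrable setT (fun p => (m2 (t - delta) p.1 p.2)%:E)) ->
  \int[P]_w running_cost delta f u X t w
  - \int[P]_w running_cost delta f us Xs t w
  + (drift_along delta b u X t - drift_along delta b us Xs t)
    * \int[P]_w Y t w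
  <= gap t * mean_present delta b sigma f dH1 us Xs Y Z t
   + if delta <= t
     then gap (t - delta)
       * mean_delayed T delta b sigma f dH2 us Xs Y Z (t - delta)
     else 0.
Proof.
move=> Iu Ius IY Ihx Im1 Idel.
set db := drift_along _ _ _ _ _ - _.
have IdbY : P.-integrable setT (EFin \o (fun w => db * Y t w)).
  by have := integrableZl measurableT db IY; exact: eq_integrable.
have Iuus : P.-integrable setT (EFin \o (fun w =>
    running_cost delta f u X t w - running_cost delta f us Xs t w)).
  by have := integrableB measurableT Iu Ius; exact: eq_integrable.
have -> : \int[P]_w running_cost delta f u X t w
    - \int[P]_w running_cost delta f us Xs t w + db * \int[P]_w Y t w =
    \int[P]_w (running_cost delta f u X t w - running_cost delta f us Xs t w
      + db * Y t w).
  by rewrite RintegralD// RintegralB// RintegralZl.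
have Im1' := integrable_partial_expectation Im1.
have Ipres0 : P.-integrable setT
    (EFin \o (fun w => hx t w + \int[P]_w' m1 t w w')).
  by have := integrableD measurableT Ihx Im1'; exact: eq_integrable.
have Ipres : P.-integrable setT
    (EFin \o (fun w => gap t * (hx t w + \int[P]_w' m1 t w w'))).
  by have := integrableZl measurableT (gap t) Ipres0; exact: eq_integrable.
have Ilhs : P.-integrable setT (EFin \o (fun w =>
    running_cost delta f u X t w - running_cost delta f us Xs t w
      + db * Y t w)).
  by have := integrableD measurableT Iuus IdbY; exact: eq_integrable.
have presE : gap t * mean_present delta b sigma f dH1 us Xs Y Z t =
    \int[P]_w (gap t * (hx t w + \int[P]_w' m1 t w w')).
  by rewrite RintegralZl// RintegralD// iterated_expectationC.
case: ifPn => [dt|]; last first.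
  rewrite -ltNge => td; rewrite addr0 presE.
  apply: ae_le_Rintegral => //.
  apply: filterS running_cost_gap => w + _.
  suff -> : gap (t - delta) = 0 by rewrite mul0r addr0 mulrC.
  rewrite /state_gap set_itv_ge ?Rintegral_set0//.
  by rewrite bnd_simp -ltNge subr_lt0.
have [Ihxb Im2] := Idel dt.
have Im2' := integrable_partial_expectation Im2.
have Idel0 : P.-integrable setT (EFin \o (fun w =>
    hxb (t - delta + delta) w * chi T delta (t - delta)
    + \int[P]_w' m2 (t - delta) w w')).
  by have := integrableD measurableT Ihxb Im2'; exact: eq_integrable.
have Idel1 : P.-integrable setT (EFin \o (fun w => gap (t - delta) * (
    hxb (t - delta + delta) w * chi T delta (t - delta)
    + \int[P]_w' m2 (t - delta) w w'))).
  by have := integrableZl measurableT (gap (t - delta)) Idel0;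
    exact: eq_integrable.
rewrite presE.
have -> : gap (t - delta)
    * mean_delayed T delta b sigma f dH2 us Xs Y Z (t - delta) =
    \int[P]_w (gap (t - delta) * (
      hxb (t - delta + delta) w * chi T delta (t - delta)
      + \int[P]_w' m2 (t - delta) w w')).
  by rewrite RintegralZl// RintegralD// iterated_expectationC.
rewrite -RintegralD//.
apply: ae_le_Rintegral => //.
  by have := integrableD measurableT Ipres Idel1; exact: eq_integrable.
have chi1 : chi T delta (t - delta) = 1.
  rewrite /chi indicE mem_set//= in_itv /= subr_ge0 dt lerD2r.
  by case/andP : t0T.
apply: filterS running_cost_gap => w + _.
rewrite /mfield2 chi1 subrK mulr1 [db * _]mulrC mulrC.
by under [X in _ -> _ <= _ + _ * (_ + X)]eq_Rintegral do rewrite mulr1.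
Qed.

End running.

Lemma terminal_cost_gap : 0 <= T ->
  {ae P, forall w, concave_g P (g w) (dg w)} ->
  P.-integrable setT (EFin \o terminal_cost T g X) ->
  P.-integrable setT (EFin \o terminal_cost T g Xs) ->
  P.-integrable setT
    (fun w => (derive1 (fun s => g w s (law_ (Xs T))) (Xs T w))%:E) ->
  (P \x P)%E.-integrable setT (fun p => (mT p.1 p.2)%:E) ->
  \int[P]_w terminal_cost T g X w - \int[P]_w terminal_cost T g Xs w
  <= gap T * (\int[P]_w derive1 (fun s => g w s (law_ (Xs T))) (Xs T w)
     + \int[P]_w (\int[P]_w' mT w' w)).
Proof.
move=> T0 concg Iu Ius Ig ImT.
have TT : - delta <= T <= T.
  by rewrite lexx andbT (le_trans _ T0)// oppr_le0 ltW.
have Xs2 := is_state_Lfun2 hXs TT.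
have X2 := is_state_Lfun2 hX TT.
have gapT := is_stateB hX hXs TT.
have ImT' := integrable_partial_expectation ImT.
rewrite -iterated_expectationC// -RintegralB// -RintegralD// -RintegralZl//.
  apply: ae_le_Rintegral => //.
  - by have := integrableB measurableT Iu Ius; exact: eq_integrable.
  - have := integrableZl measurableT (gap T) (integrableD measurableT Ig ImT').
    exact: eq_integrable.
  apply: filterS2 (gapT) concg => w XTw concw _.
  have I1 : _ = gap T * \int[P]_w' mT w w' :=
    Rintegral_mderiv_shift (hdH.2 w (Xs T w) _ (P2_distribution Xs2)).1 gapT.
  set A1 := LHS in I1.
  have conc : terminal_cost T g X w - terminal_cost T g Xs w
      - derive1 (fun s => g w s (law_ (Xs T))) (Xs T w) * (X T w - Xs T w)
      - A1 <= 0.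
    exact: (concw (Xs T w) (X T w) _ _ (Lfun_Sub (lee1n 2) Xs2)
      (Lfun_Sub (lee1n 2) X2) (has_law_Lfun_Sub Xs2) (has_law_Lfun_Sub X2)).
  move: conc; rewrite I1 XTw; lra.
by have := integrableD measurableT Ig ImT'; exact: eq_integrable.
Qed.

End optimality.

Lemma cost_Rintegral d (Om : measurableType d) (R : realType)
    (P : probability Om R) (T delta : R)
    (f : Om -> R -> R -> R -> law R -> law R -> R -> R)
    (g : Om -> R -> law R -> R) (u X : R -> {RV P >-> R}) :
  finite_cost T delta f g u X ->
  cost T delta f g u X = \int[P]_w terminal_cost T g X w
    + \int[lebesgue_measure]_(t in `[0, T])
        (\int[P]_w running_cost delta f u X t w).
Proof.
move=> [Ig If]; have m0T := measurable_segment 0 T.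
rewrite /cost RintegralD//; last exact: (integrable_Rintegral2 m0T If).
by rewrite (Fubini_Rintegral m0T If).
Qed.

Theorem theorem5p2
  (d : measure_display) (Om : measurableType d) (R : realType)
  (P : probability Om R) (hP : measure_is_complete P)
  (T delta h : R) (hT : 0 < T) (hdelta : 0 < delta) (hh : 2^-1 < h < 1)
  (B : R -> {RV P >-> R}) (hB : is_fbm T h B)
  (U : set R) (hU : open U \/ is_interval U)
  (b : R -> law R -> law R -> law R -> R)
  (sigma : R -> R) (hsigma : in_calH T h sigma)
  (x0 : R -> R) (hx0 : {within `[- delta, 0], continuous x0})
  (f : Om -> R -> R -> R -> law R -> law R -> R -> R)
  (g : Om -> R -> law R -> R)
  (hfg : coefficients_adapted T U B f g)
  (hC1 : exists C : R, coefficients_C1 T U f g C)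
  (hmd : exists C : R, coefficients_mderiv P T U b f g C)
  (dH1 dH2 dH3 :
     Om -> R -> R -> R -> R -> law R -> law R -> law R -> R -> R -> R -> R)
  (dg : Om -> R -> law R -> R -> R)
  (hdH : are_mderivs P T U b sigma f g dH1 dH2 dH3 dg)
  (X : (R -> {RV P >-> R}) -> R -> {RV P >-> R})
  (hX : forall u, admissible T U B u ->
     [/\ is_state T delta h B b sigma x0 u (X u),
         sq_integrable_process P T (X u) &
         finite_cost T delta f g u (X u)])
  (us : R -> {RV P >-> R}) (hus : admissible T U B us)
  (Ys Zs : R -> Om -> R)
  (hadj : adjoint_solution T delta h B b sigma f g dH1 dH2 dg us (X us) Ys Zs)
  (h1 : forall u, admissible T U B u ->
     dom_divergence T h B (fun t w => X u t w * Zs t w))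
  (h2H : forall t : R, 0 <= t <= T -> {ae P, forall w,
     concave_H P U
       (fun x xb v m1 m2 m3 =>
          hamiltonian b sigma f w t x xb v m1 m2 m3 (Ys t w) (Zs t w))
       (fun x xb v m1 m2 m3 => dH1 w t x xb v m1 m2 m3 (Ys t w) (Zs t w))
       (fun x xb v m1 m2 m3 => dH2 w t x xb v m1 m2 m3 (Ys t w) (Zs t w))
       (fun x xb v m1 m2 m3 => dH3 w t x xb v m1 m2 m3 (Ys t w) (Zs t w))})
  (h2g : {ae P, forall w, concave_g P (g w) (dg w)})
  (h3 : forall t : R, 0 <= t <= T -> (us t : Om -> R) \in Lfun P 2%:E ->
     {ae P, forall w,
       let Ht v := hamiltonian b sigma f w t
         (X us t w) (X us (t - delta) w) v
         (distribution P (X us t)) (distribution P (X us (t - delta)))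
         (distribution P (us t)) (Ys t w) (Zs t w) in
       (Ht (us t w))%:E = ereal_sup [set (Ht v)%:E | v in U]})
  (h4 : forall t : R, 0 <= t <= T -> (us t : Om -> R) \in Lfun P 2%:E ->
     {ae P, forall w, {ae P, forall w',
       dH3 w t (X us t w) (X us (t - delta) w) (us t w)
         (distribution P (X us t)) (distribution P (X us (t - delta)))
         (distribution P (us t)) (Ys t w) (Zs t w) (us t w') = 0}}) :
  (cost T delta f g us (X us))%:E =
  ereal_sup [set (cost T delta f g u (X u))%:E | u in admissible T U B].
Proof.
have {hC1} [C hC1] := hC1.
have [stus _ fcs] := hX us hus.
apply/eqP; rewrite eq_le; apply/andP; split.
  by apply: ereal_sup_ubound; exists us.
apply: ge_ereal_sup => _ [u hu <-]; rewrite lee_fin.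
have [stu _ fcu] := hX u hu.
have [[Uus _ _] [Uu _ _]] := (hus, hu).
have T0 := ltW hT.
have m0T := measurable_segment 0 T.
have admissible_Lfun2 v : admissible T U B v -> {ae lebesgue_measure,
    forall t : R, 0 <= t <= T -> (v t : Om -> R) \in Lfun P 2%:E}.
  move=> [_ _ [_ Iv2]]; have := ae_integrable_section1 m0T Iv2.
  apply: filterS => t Iv t0T; apply/Lfun2P; split=> //.
  by apply: Iv; rewrite /= in_itv.
have [D [ID DE EY]] := adjoint_mean hadj T0.
have IM := integrable_mean_present hadj.
set M := mean_present _ _ _ _ _ _ _ _ _ in IM EY.
set db := fun s : R => drift_along delta b u (X u) s
  - drift_along delta b us (X us) s.
set gap := state_gap delta b u (X u) us (X us).
have Idb : lebesgue_measure.-integrable `[0, T] (EFin \o db).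
  have [[_ Iu _] [_ Is _]] := (stu, stus).
  by have := integrableB m0T Iu Is; exact: eq_integrable.
have IMD : lebesgue_measure.-integrable `[0, T] (EFin \o (fun s => M s + D s)).
  by have := integrableD m0T IM ID; exact: eq_integrable.
set EYT := \int[P]_w Ys T w in EY.
have terminal : \int[P]_w terminal_cost T g (X u) w
    - \int[P]_w terminal_cost T g (X us) w <= gap T * EYT.
  rewrite /EYT (adjoint_terminal_mean hadj T0).
  case: hadj => _ _ [Ig IT] _.
  exact: (terminal_cost_gap hdelta hdH stus stu T0 h2g fcu.1 fcs.1 Ig IT).
have Iru := integrable_Rintegral1 m0T fcu.2.
have Irs := integrable_Rintegral1 m0T fcs.2.
(* [k (t - delta)] is the delayed part of the drift of [Ys], moved to the time
   at which it enters the Hamiltonian; it vanishes for [t < delta], as does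
   the gap between the two states at time [t - delta]. *)
pose k := (fun s => gap s * D s) \_ `[0, T - delta].
have IgM : lebesgue_measure.-integrable `[0, T]
    (EFin \o (fun s => gap s * M s)).
  exact: integrable_primitive_mul Idb IM.
have IgD : lebesgue_measure.-integrable `[0, T]
    (EFin \o (fun s => gap s * D s)).
  exact: integrable_primitive_mul Idb ID.
have Iks : lebesgue_measure.-integrable `[0, T]
    (EFin \o (fun t => k (t - delta))).
  exact: integrable_delay (ltW hdelta) IgD.
have kE : \int[lebesgue_measure]_(t in `[0, T]) k (t - delta) =
    \int[lebesgue_measure]_(s in `[0, T]) (gap s * D s).
  apply: (Rintegral_delay (ltW hdelta) IgD).
  apply: filterS DE => s DE s0T sT.
  by rewrite DE// mean_delayed0 ?mulr0.
have Itail : lebesgue_measure.-integrable `[0, T] (EFin \o (fun t =>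
    db t * \int[lebesgue_measure]_(s in `[t, T]) (M s + D s))).
  exact: integrable_mul_tail_integral Idb IMD.
have IEdb : lebesgue_measure.-integrable `[0, T]
    (EFin \o (fun t => EYT * db t)).
  by have := integrableZl m0T EYT Idb; exact: eq_integrable.
have IdbY : lebesgue_measure.-integrable `[0, T] (EFin \o (fun t => EYT * db t
    + db t * \int[lebesgue_measure]_(s in `[t, T]) (M s + D s))).
  by have := integrableD m0T IEdb Itail; exact: eq_integrable.
have Irr : lebesgue_measure.-integrable `[0, T] (EFin \o (fun t =>
    \int[P]_w running_cost delta f u (X u) t w
     - \int[P]_w running_cost delta f us (X us) t w)).
  by have := integrableB m0T Iru Irs; exact: eq_integrable.
have running : \int[lebesgue_measure]_(t in `[0, T])
    (\int[P]_w running_cost delta f u (X u) t w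
     - \int[P]_w running_cost delta f us (X us) t w
     + (EYT * db t
        + db t * \int[lebesgue_measure]_(s in `[t, T]) (M s + D s))) <=
    \int[lebesgue_measure]_(t in `[0, T]) (gap t * M t + k (t - delta)).
  apply: ae_le_Rintegral => //.
  - by have := integrableD m0T Irr IdbY; exact: eq_integrable.
  - by have := integrableD m0T IgM Iks; exact: eq_integrable.
  have Su := ae_integrable_section1 m0T fcu.2.
  have Ss := ae_integrable_section1 m0T fcs.2.
  have Lu := admissible_Lfun2 u hu.
  have Ls := admissible_Lfun2 us hus.
  have Sadj := adjoint_section_integrable hadj.
  have Sadjd := ae_shift delta Sadj.
  have DEd := ae_shift delta DE.
  have I := @filterI _ _ (lebesgue_ae_filter R).
  have costs := I _ _ (I _ _ Su Ss) (I _ _ Lu Ls).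
  have adjs := I _ _ (I _ _ Sadj Sadjd) DEd.
  apply: filterS2 (costs) (adjs).
  move=> t [[rut rst] [ut2 ust2]] [[adjt adjtd] DEt] tT.
  have t0T : 0 <= t <= T by move: tT; rewrite /= in_itv.
  have dt0T : delta <= t -> 0 <= t - delta <= T.
    rewrite subr_ge0 => ->; case/andP : t0T => _ tT'.
    by rewrite (le_trans _ tT')// gerBl ltW.
  have [Yt EYt] := EY t t0T.
  have [hxt m1t _ _] := adjt t0T.
  have := running_cost_gap_mean hdelta hU hC1 hdH stus stu t0T
    (fun w => Uus t w t0T) (fun w => Uu t w t0T) (ust2 t0T) (ut2 t0T)
    (h2H t t0T) (h3 t t0T (ust2 t0T)) (h4 t t0T (ust2 t0T)) (rut tT) (rst tT)
    Yt hxt m1t _.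
  rewrite EYt mulrDr [_ * EYT]mulrC => /(_ _)/le_trans; apply.
    by move=> /dt0T/adjtd[].
  rewrite lerD2l /k patchE mem_setE in_itv /= subr_ge0 lerD2r.
  case/andP : t0T => _ ->; rewrite andbT.
  by case: ifPn => // /dt0T/DEt ->.
rewrite RintegralD// [in leLHS]RintegralB// RintegralD// in running.
rewrite RintegralZl// Rintegral_mul_tail_integral// in running.
rewrite [leRHS]RintegralD// kE in running.
have MDE : \int[lebesgue_measure]_(s in `[0, T]) (gap s * (M s + D s)) =
    \int[lebesgue_measure]_(s in `[0, T]) (gap s * M s)
    + \int[lebesgue_measure]_(s in `[0, T]) (gap s * D s).
  by rewrite -RintegralD//; apply: eq_Rintegral => s _; rewrite mulrDr.
have gapTE : \int[lebesgue_measure]_(t in `[0, T]) db t = gap T by [].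
rewrite !cost_Rintegral//.
move: running terminal; rewrite MDE gapTE; lra.
Qed.
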